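(* For any integer $n\geq 3$, the number of derivations on $M_n$ is $$2+\sum_{k=1}^{n-2}(k+1)\binom{n-2}{k},$$ and there are exactly $2(n-1)$ isomorphic classes of derivations on $M_n$.
   Context: For $n\geq 3$, $M_n=\{0,b_1,b_2,\dots,b_{n-2},1\}$ is the $n$-element diamond type lattice with bottom $0$, top $1$, and $n-2$ pairwise incomparable elements $b_1,\dots,b_{n-2}$ strictly between $0$ and $1$ (so $b_i\wedge b_j=0$ and $b_i\vee b_j=1$ for $i\neq j$). A derivation on a bounded lattice $L$ is a map $d:L\to L$ with $d(x\wedge y)=(d(x)\wedge y)\vee(x\wedge d(y))$ for all $x,y\in L$. Two derivations $d,d'$ on $L$ are isomorphic, written $d\cong d'$, if there is a lattice automorphism $f:L\to L$ with $f\circ d=d'\circ f$. This is an equivalence relation on the set of derivations on $L$, and its equivalence classes are called the isomorphic classes of derivations on $L$. *)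

(* Defs.v *)
From HB Require Import structures.
From mathcomp Require Import all_boot all_order all_fingroup.

Set Implicit Arguments.
Unset Strict Implicit.
Unset Printing Implicit Defensive.

Section Derivations.

Context {disp : Order.disp_t} {L : finTBLatticeType disp}.

Definition is_derivation (d : {ffun L -> L}) : bool :=
  [forall x, forall y,
    d (x `&` y)%O == ((d x `&` y) `|` (x `&` d y))%O].

Lemma is_derivationP (d : {ffun L -> L}) :
  reflect (forall x y, d (x `&` y)%O = ((d x `&` y) `|` (x `&` d y))%O)
          (is_derivation d).
Proof.
by apply: (iffP 'forall_forallP) => dP x y; apply/eqP/dP.
Qed.

Definition is_automorphism (f : {perm L}) : bool :=
  [forall x, forall y, (f (x `&` y) == f x `&` f y)%O &&
                       (f (x `|` y) == f x `|` f y)%O].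

Lemma is_automorphismP (f : {perm L}) :
  reflect (Order.meet_morphism f /\ Order.join_morphism f)
          (is_automorphism f).
Proof.
apply: (iffP 'forall_forallP) => [fP | [fI fU] x y].
  by split=> x y; case/andP: (fP x y) => /eqP ? /eqP.
by rewrite fI fU !eqxx.
Qed.

Definition derivation_iso (d d' : {ffun L -> L}) : bool :=
  [exists f : {perm L},
    is_automorphism f && [forall x, f (d x) == d' (f x)]].

Lemma derivation_isoP (d d' : {ffun L -> L}) :
  reflect (exists2 f : {perm L}, is_automorphism f & f \o d =1 d' \o f)
          (derivation_iso d d').
Proof.
apply: (iffP existsP) => [[f /andP[fa /forallP fd]] | [f fa fd]]; exists f => //.
  by move=> x; apply/eqP/fd.
by rewrite fa; apply/forallP=> x; apply/eqP/fd.
Qed.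

Lemma derivation_iso_refl : reflexive derivation_iso.
Proof.
move=> d; apply/derivation_isoP; exists 1%g => [|x]; last by rewrite /= !perm1.
by apply/is_automorphismP; split=> x y; rewrite !perm1.
Qed.

Lemma derivation_iso_sym : symmetric derivation_iso.
Proof.
suff sym d d' : derivation_iso d d' -> derivation_iso d' d.
  by move=> d d'; apply/idP/idP; apply: sym.
case/derivation_isoP=> f /is_automorphismP[fI fU] fd.
apply/derivation_isoP; exists f^-1%g.
  by apply/is_automorphismP; split=> x y; apply: (@perm_inj _ f);
     rewrite ?fI ?fU !permKV.
by move=> x /=; apply: (@perm_inj _ f); move: (fd (f^-1%g x)) => /= ->;
   rewrite !permKV.
Qed.

Lemma derivation_iso_trans : transitive derivation_iso.
Proof.
move=> d2 d1 d3 /derivation_isoP[f /is_automorphismP[fI fU] fd].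
case/derivation_isoP=> g /is_automorphismP[gI gU] gd.
apply/derivation_isoP; exists (f * g)%g => [|x /=].
  by apply/is_automorphismP; split=> x y; rewrite !permM ?fI ?fU ?gI ?gU.
by move: (fd x) (gd (f x)) => /= fdx gdx; rewrite !permM fdx gdx.
Qed.

End Derivations.

Definition derivations {disp : Order.disp_t} (L : finTBLatticeType disp) :
    {set {ffun L -> L}} :=
  [set d | is_derivation d].

Definition derivation_classes {disp : Order.disp_t}
    (L : finTBLatticeType disp) : {set {set {ffun L -> L}}} :=
  equivalence_partition derivation_iso (derivations L).

(* [diamond n] has elements 0, 1 and n - 2 atoms indexed by 'I_(n - 2), so it  *)
(* has n elements only if n >= 2: see card_diamond.                           *)
Variant diamond (n : nat) := DBot | DAtom of 'I_(n - 2) | DTop.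
Arguments DBot {n}.
Arguments DAtom {n} i.
Arguments DTop {n}.

Section DiamondLattice.

Variable n : nat.
Implicit Types x y z : diamond n.

Definition diamond_code x : option (option 'I_(n - 2)) :=
  match x with
  | DBot => None
  | DTop => Some None
  | DAtom i => Some (Some i)
  end.

Definition diamond_decode (c : option (option 'I_(n - 2))) : diamond n :=
  match c with
  | None => DBot
  | Some None => DTop
  | Some (Some i) => DAtom i
  end.

Lemma diamond_codeK : cancel diamond_code diamond_decode.
Proof. by case. Qed.

Lemma diamond_decodeK : cancel diamond_decode diamond_code.
Proof. by case=> [[]|]. Qed.

HB.instance Definition _ := Finite.copy (diamond n) (can_type diamond_codeK).

Definition diamond_le x y : bool :=
  match x, y with
  | DBot, _ => true
  | _, DTop => true
  | DAtom i, DAtom j => i == j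
  | _, _ => false
  end.

Definition diamond_meet x y : diamond n :=
  match x, y with
  | DTop, z => z
  | z, DTop => z
  | DAtom i, DAtom j => if i == j then DAtom i else DBot
  | _, _ => DBot
  end.

Definition diamond_join x y : diamond n :=
  match x, y with
  | DBot, z => z
  | z, DBot => z
  | DAtom i, DAtom j => if i == j then DAtom i else DTop
  | _, _ => DTop
  end.

Fact diamond_le_refl : reflexive diamond_le.
Proof. by case=> //= i. Qed.

Fact diamond_le_anti : antisymmetric diamond_le.
Proof. by case=> [|i|] [|j|] //= /andP[/eqP->]. Qed.

Fact diamond_le_trans : transitive diamond_le.
Proof. by case=> [|j|] [|i|] [|k|] //= /eqP->. Qed.

Fact diamond_display : Order.disp_t. Proof. exact: Order.Disp tt tt. Qed.

HB.instance Definition _ := Order.Le_isPOrder.Build diamond_display (diamond n)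
  diamond_le_refl diamond_le_anti diamond_le_trans.

Fact diamond_meetP x y z :
  (x <= diamond_meet y z)%O = (x <= y)%O && (x <= z)%O.
Proof.
rewrite /Order.le /=; case: x y z => [|i|] [|j|] [|k|] //=;
  rewrite ?andbT ?andbF ?andbb //; case: (eqVneq j k) => //= [->|njk].
  by rewrite andbb.
by case: (eqVneq i j) => [->|] //=; rewrite (negPf njk).
Qed.

Fact diamond_joinP x y z :
  (diamond_join x y <= z)%O = (x <= z)%O && (y <= z)%O.
Proof.
rewrite /Order.le /=; case: x y z => [|i|] [|j|] [|k|] //=;
  rewrite ?andbT ?andbF ?andbb //; case: (eqVneq i j) => //= [->|nij].
  by rewrite andbb.
by case: (eqVneq j k) => [<-|]; rewrite ?andbF ?(negPf nij).
Qed.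

HB.instance Definition _ := Order.POrder_MeetJoin_isLattice.Build
  diamond_display (diamond n) diamond_meetP diamond_joinP.

Fact diamond_le0x x : (DBot <= x)%O. Proof. by []. Qed.
Fact diamond_lex1 x : (x <= DTop)%O. Proof. by case: x. Qed.

HB.instance Definition _ :=
  Order.hasBottom.Build diamond_display (diamond n) diamond_le0x.
HB.instance Definition _ :=
  Order.hasTop.Build diamond_display (diamond n) diamond_lex1.

Lemma diamond_meet_atoms (i j : 'I_(n - 2)) :
  i != j -> (DAtom i `&` DAtom j)%O = \bot%O :> diamond n.
Proof. by move=> nij; rewrite /Order.meet /= (negPf nij). Qed.

Lemma diamond_join_atoms (i j : 'I_(n - 2)) :
  i != j -> (DAtom i `|` DAtom j)%O = \top%O :> diamond n.
Proof. by move=> nij; rewrite /Order.join /= (negPf nij). Qed.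

Lemma card_diamond : 1 < n -> #|{: diamond n}| = n.
Proof.
have /bij_eq_card -> : bijective diamond_code.
  by exists diamond_decode; [apply: diamond_codeK | apply: diamond_decodeK].
by rewrite !card_option card_ord; case: n => [|[|m]] // _; rewrite subSS subn1.
Qed.

End DiamondLattice.

(* Main.v *)
Require Import Defs.
From mathcomp Require Import all_boot all_order all_fingroup.
From mathcomp Require Import zify.

Import Order.LTheory.

(** A derivation [d] of a bounded lattice satisfies [d x <= x] and
    [x `&` d \top <= d x].  On the diamond, the first inequality says that [d]
    kills the bottom and either fixes or kills each atom, so that [d] is
    determined by the set [S] of atoms that it fixes and by the value
    [t = d \top]; the second one says that [S] contains the atom [t] when [t] is
    an atom, and that [S] is the set of all atoms when [t] is the top.
    Conversely all such pairs [(S, t)] give derivations ([derivations_diamond]).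
    For each [S] the value [t] can be the bottom or any element of [S], which
    makes [#|S| + 1] derivations, and [S] full with [t] the top gives one more,
    the identity.  Grouping the sets [S] by cardinality yields the first formula.

    The automorphisms of the diamond are the permutations of its atoms, and
    conjugating by such a permutation moves the pair [(S, t)] accordingly
    ([derivation_iso_diamond]).  Hence the class of a derivation is determined by
    the cardinality of [S] and the nature of [t] (bottom, atom or top).  With
    [m] atoms there are [m + 1] classes with [t] the bottom ([0 <= #|S| <= m]),
    [m] classes with [t] an atom ([1 <= #|S| <= m]) and one with [t] the top.
    The function [class_index] numbers these possibilities from [0] to
    [2 * m + 1], and the number of classes is the cardinality of its image. *)

(** * Auxiliary facts on finite sets *)

(** When a relation is the kernel of [f] on [D], its classes are in bijection
    with the values of [f]. *)
Lemma card_equivalence_partition_kernel (T T' : finType) (R : rel T)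
    (f : T -> T') (D : {set T}) :
    {in D &, forall x y, R x y = (f x == f y)} ->
  #|equivalence_partition R D| = #|f @: D|.
Proof.
move=> Rf; pose fibre k := [set y in D | k == f y].
have -> : equivalence_partition R D = fibre @: (f @: D).
  rewrite /equivalence_partition -imset_comp; apply: eq_in_imset => x Dx /=.
  by apply/setP=> y; rewrite !inE; case Dy: (y \in D) => //=; rewrite Rf.
apply: card_in_imset => _ _ /imsetP[x Dx ->] /imsetP[y Dy ->] /setP/(_ x).
by rewrite !inE Dx eqxx => /esym/eqP->.
Qed.

Lemma exists_perm_imset (m : nat) (S S' : {set 'I_m}) :
  #|S| = #|S'| -> exists s : {perm 'I_m}, s @: S = S'.
Proof.
move=> eqS.
(* A permutation matching the indicator sequences of the two sets. *)
have : perm_eq [tuple i \in S | i < m] [tuple i \in S' | i < m].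
  have count_ind (U : {set 'I_m}) (a : pred bool) :
      count a [tuple i \in U | i < m] = a true * #|U| + a false * (m - #|U|).
    have -> : m - #|U| = #|~: U| by rewrite [RHS]cardsCs setCK card_ord.
    rewrite count_map -sum1_count big_enum_cond /= (bigID (mem U)) /=.
    rewrite -!sum1_card !big_distrr /=.
    by congr (_ + _); rewrite [LHS]big_mkcond [RHS]big_mkcond /=;
      apply: eq_bigr => i _; rewrite ?inE; case: (i \in U); case: (a _).
  by apply/seq.permP => a; rewrite !count_ind eqS.
case/tuple_permP => s /val_inj eq_s; exists s.
apply/eqP; rewrite eqEcard card_imset ?eqS ?leqnn ?andbT; last exact: perm_inj.
apply/subsetP=> _ /imsetP[i Si ->].
by have := congr1 (fun u => tnth u i) eq_s; rewrite !tnth_mktuple Si => <-.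
Qed.

Lemma exists_perm_imset_point (m : nat) (S S' : {set 'I_m}) (i i' : 'I_m) :
    #|S| = #|S'| -> i \in S -> i' \in S' ->
  exists2 s : {perm 'I_m}, s @: S = S' & s i = i'.
Proof.
move=> /exists_perm_imset[s sS] Si S'i'.
have S'si : s i \in S' by rewrite -sS imset_f.
(* Composing with a transposition internal to [S'] adjusts the image of [i]. *)
exists (s * tperm (s i) i')%g; last by rewrite permM tpermL.
apply/eqP; rewrite eqEcard card_imset; last exact: perm_inj.
rewrite -{2}sS card_imset ?leqnn ?andbT; last exact: perm_inj.
apply/subsetP=> _ /imsetP[j Sj ->]; rewrite permM.
by case: tpermP => // _ _; rewrite -sS imset_f.
Qed.

Lemma exists_card_set (m k : nat) :
  k <= m -> exists S : {set 'I_m}, #|S| = k.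
Proof.
move=> le_km; have : 0 < #|[set S : {set 'I_m} | #|S| == k]|.
  by rewrite card_draws card_ord bin_gt0.
by case/card_gt0P=> S; rewrite inE => /eqP; exists S.
Qed.

(** * Derivations on a bounded lattice *)

Lemma derivation_le {disp : Order.disp_t} {L : finTBLatticeType disp}
    {d : {ffun L -> L}} : is_derivation d -> forall x, (d x <= x)%O.
Proof.
move=> /is_derivationP dP x.
by have := dP x x; rewrite meetxx (meetC x) joinxx => ->;
  rewrite leIr.
Qed.

Lemma derivation_meet_top {disp : Order.disp_t} {L : finTBLatticeType disp}
    {d : {ffun L -> L}} :
  is_derivation d -> forall x, (x `&` d \top <= d x)%O.
Proof.
move=> /is_derivationP dP x.
by have := dP x \top%O; rewrite !meetx1 => ->; rewrite leUr.
Qed.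

(** * Derivations on the diamond *)

Section Diamond.

Variable n : nat.
Implicit Types (S : {set 'I_(n - 2)}) (t : diamond n) (s : {perm 'I_(n - 2)}).

(** The map that fixes the atoms of [S], kills the other ones and the bottom,
    and sends the top to [t]. *)
Definition diamond_der S t : {ffun diamond n -> diamond n} :=
  [ffun x => match x with
             | DBot => DBot
             | DAtom i => if i \in S then DAtom i else DBot
             | DTop => t
             end].

(** The condition on [S] and [t] for [diamond_der S t] to be a derivation: every
    atom below [t] belongs to [S]. *)
Definition admissible S t : bool :=
  match t with
  | DBot => true
  | DAtom i => i \in S
  | DTop => S == setT
  end.

Lemma diamond_der_inj S t S' t' :
  diamond_der S t = diamond_der S' t' -> S = S' /\ t = t'.
Proof.
move=> /ffunP eq_d; split; last by have := eq_d DTop; rewrite !ffunE.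
apply/setP=> i; have := eq_d (DAtom i); rewrite !ffunE.
by case: (i \in S); case: (i \in S').
Qed.

Lemma diamond_der_derivation S t :
  admissible S t -> is_derivation (diamond_der S t).
Proof.
move=> adm; apply/is_derivationP=> x y; rewrite !ffunE.
rewrite /Order.meet /Order.join /=.
case: x => [|i|]; case: y => [|j|] //=.
- by case: (j \in S).
- by case: t {adm}.
- by case: (i \in S).
- case: eqVneq => [<-|nij].
    by case: (i \in S); rewrite /= ?eqxx /= ?eqxx.
  by case: (i \in S); case: (j \in S); rewrite /= ?(negPf nij).
- case: t adm => [_|k /= Sk|/eqP->]; last by rewrite inE /= ?eqxx /= ?eqxx.
    by case: (i \in S).
  case: (eqVneq i k) Sk => [->|/negPf nik _].
    by move->; rewrite /= ?eqxx /= ?eqxx.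
  by case: (i \in S).
- by case: t {adm}.
- case: t adm => [_|k /= Sk|/eqP->] //; last by rewrite inE /= ?eqxx /= ?eqxx.
  case: (eqVneq k j) Sk => [->|/negPf nkj _].
    by move->; rewrite /= ?eqxx /= ?eqxx.
  by case: (j \in S).
- by case: t {adm} => //= k; rewrite eqxx.
Qed.

Lemma derivations_diamond (d : {ffun diamond n -> diamond n}) :
  reflect (exists S t, admissible S t /\ d = diamond_der S t)
          (d \in derivations (diamond n)).
Proof.
rewrite inE; apply: (iffP idP) => [dd | [S [t [adm ->]]]]; last first.
  exact: diamond_der_derivation.
have dle := derivation_le dd; have dtop := derivation_meet_top dd.
change \top%O with (@DTop n) in dtop.
exists [set i | d (DAtom i) == DAtom i], (d DTop); split.
  case dT: (d DTop) dtop => [|i|] dtop //=.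
    rewrite inE; have := dle (DAtom i); have := dtop (DAtom i).
    rewrite /Order.meet /= eqxx /Order.le /=.
    by case: (d _) => //= j /eqP->.
  apply/eqP/setP=> i; rewrite !inE; have := dle (DAtom i); have := dtop (DAtom i).
  by rewrite /Order.le /=; case: (d _) => //= j /eqP->.
apply/ffunP=> x; rewrite ffunE; have := dle x; rewrite /Order.le.
case: x => [|i|] //=; first by case: (d _).
by rewrite inE; case: (d _) => //= j /eqP->; rewrite eqxx.
Qed.

(** * Counting the derivations *)

(** The last term counts [t] the top, admissible only for the full set. *)
Lemma card_admissible S :
  #|[set t | admissible S t]| = #|S| + 1 + (S == setT).
Proof.
have notDAtom t : (forall i, t <> DAtom i) -> t \in (@DAtom n) @: S = false.
  by move=> neq; apply/imsetP=> [[i _ /neq]].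
have inDAtom i : (DAtom i \in (@DAtom n) @: S) = (i \in S).
  by rewrite mem_imset // => ? ? [].
have -> : [set t | admissible S t] =
    [set t | (t == DTop) && (S == setT)] :|: (DBot |: (@DAtom n) @: S).
  by apply/setP=> -[|i|]; rewrite !inE ?inDAtom ?notDAtom //= orbF.
have /disjoint_setI0 disj :
    [disjoint [set t | (t == DTop) && (S == setT)] & DBot |: (@DAtom n) @: S].
  apply/pred0P=> t; rewrite /= !inE; case: eqVneq => //= ->.
  by rewrite notDAtom ?andbF.
rewrite cardsU disj cards0 subn0 cardsU1 notDAtom //.
rewrite card_imset; last by move=> ? ? [].
rewrite addnC (addnC 1); congr (_ + _).
case: (S == setT).
  by rewrite (eq_card1 (x := DTop)) // => t; rewrite !inE andbT.
by rewrite eq_card0 // => t; rewrite inE andbF.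
Qed.

Lemma card_derivations_diamond :
  #|derivations (diamond n)| = \sum_(S : {set 'I_(n - 2)}) (#|S| + 1) + 1.
Proof.
pose P := [set p : {set 'I_(n - 2)} * diamond n | admissible p.1 p.2].
have -> : derivations (diamond n) = (fun p => diamond_der p.1 p.2) @: P.
  apply/setP=> d; apply/derivations_diamond/imsetP.
    by case=> S [t [adm ->]]; exists (S, t); rewrite ?inE.
  by case=> -[S t]; rewrite inE /= => adm ->; exists S, t.
rewrite card_imset; last by case=> S t [S' t'] /= /diamond_der_inj[-> ->].
rewrite -sum1dep_card -(pair_big_dep xpredT admissible (fun _ _ => 1)) /=.
under eq_bigr do rewrite sum1dep_card card_admissible.
rewrite big_split /=; congr (_ + _).
by rewrite (bigD1 setT) //= eqxx big1 // => S /negPf->.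
Qed.

(** * Isomorphism classes *)

(** The map of the diamond induced by a permutation of its atoms. *)
Definition diamond_map s (x : diamond n) : diamond n :=
  if x is DAtom i then DAtom (s i) else x.

Lemma diamond_map_inj s : injective (diamond_map s).
Proof. by case=> [|i|] [|j|] //= [/perm_inj->]. Qed.

Definition diamond_perm s : {perm diamond n} := perm (diamond_map_inj s).

Lemma diamond_perm_automorphism s : is_automorphism (diamond_perm s).
Proof.
apply/is_automorphismP; split=> -[|i|] [|j|];
  rewrite !permE /Order.meet /Order.join //= (inj_eq perm_inj);
  by case: (i == j).
Qed.

Lemma automorphism_diamondP (f : {perm diamond n}) :
  is_automorphism f -> exists s, f = diamond_perm s.
Proof.
case/is_automorphismP=> fI fU.
have f0 : f DBot = DBot.
  have := fI DBot (f^-1%g DBot); rewrite permKV.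
  by rewrite (meet0x (_ : diamond n)) (meetx0 (_ : diamond n)).
have f1 : f DTop = DTop.
  have := fU DTop (f^-1%g DTop); rewrite permKV.
  by rewrite (join1x (_ : diamond n)) (joinx1 (_ : diamond n)).
pose g i := if f (DAtom i) is DAtom j then j else i.
have fg i : f (DAtom i) = DAtom (g i).
  rewrite /g; case fi: (f (DAtom i)) => [|j|] //.
    by move: fi; rewrite -f0 => /perm_inj.
  by move: fi; rewrite -f1 => /perm_inj.
have g_inj : injective g.
  move=> i j eq_g; have /perm_inj[//] : f (DAtom i) = f (DAtom j).
  by rewrite !fg eq_g.
exists (perm g_inj); apply/permP=> x; rewrite permE.
by case: x => [|i|] //=; rewrite permE.
Qed.

Lemma derivation_iso_diamond S t S' t' :
  reflect (exists s, s @: S = S' /\ diamond_map s t = t')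
          (derivation_iso (diamond_der S t) (diamond_der S' t')).
Proof.
apply: (iffP (derivation_isoP _ _)) => [[f /automorphism_diamondP[s ->]] fd | ].
  exists s; split; last by have := fd DTop; rewrite /= !permE !ffunE.
  have memS i : (s i \in S') = (i \in S).
    have := fd (DAtom i); rewrite /= !ffunE !permE /=.
    by case: (i \in S); case: (s i \in S').
  apply/setP=> i; rewrite -[i](permKV s) memS mem_imset //; exact: perm_inj.
case=> s [<- <-]; exists (diamond_perm s).
  exact: diamond_perm_automorphism.
move=> x; rewrite /= !permE !ffunE; case: x => [|i|] //=.
rewrite mem_imset; last exact: perm_inj.
by case: (i \in S).
Qed.

Definition fixed_atoms (d : {ffun diamond n -> diamond n}) : {set 'I_(n - 2)} :=
  [set i | d (DAtom i) == DAtom i].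

(** The number of the isomorphism class of a derivation [d] with [k] fixed
    atoms: [k] if [d] kills the top, [m + k] if it sends the top to an atom,
    and [2 * m + 1] if it fixes the top, where [m] is the number of atoms.  In
    the second case [k] is positive, so the three ranges do not overlap.  All
    these numbers are below [2 * m + 2], so that [inord] does not change them. *)
Definition class_index (d : {ffun diamond n -> diamond n}) :
    'I_(2 * (n - 2)).+2 :=
  inord (match d DTop with
         | DBot => #|fixed_atoms d|
         | DAtom _ => n - 2 + #|fixed_atoms d|
         | DTop => (2 * (n - 2)).+1
         end).

Lemma class_index_der S t :
  class_index (diamond_der S t) =
  match t with
  | DBot => #|S|
  | DAtom _ => n - 2 + #|S|
  | DTop => (2 * (n - 2)).+1
  end :> nat.
Proof.
have -> : class_index (diamond_der S t) =
    inord (match t with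
           | DBot => #|S|
           | DAtom _ => n - 2 + #|S|
           | DTop => (2 * (n - 2)).+1
           end).
  rewrite /class_index ffunE (_ : fixed_atoms _ = S) //.
  by apply/setP=> i; rewrite inE ffunE; case: (i \in S); rewrite ?eqxx.
have leS : #|S| <= n - 2 by rewrite -[leqRHS]card_ord max_card.
rewrite inordK //; case: t => [|_|] //; rewrite mul2n -addnn !ltnS.
  by rewrite (leq_trans leS) // -addnS leq_addr.
by rewrite -addnS leq_add2l leqW.
Qed.

(** Equal indices force [t] and [t'] to be of the same nature and [S] and [S'] to
    have the same cardinality; a permutation of the atoms that maps [S] onto [S']
    can then be chosen to map [t] to [t']. *)
Lemma derivation_iso_class_index :
  {in derivations (diamond n) &, forall d d',
    derivation_iso d d' = (class_index d == class_index d')}.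
Proof.
move=> d d' /derivations_diamond[S [t [adm ->]]].
move=> /derivations_diamond[S' [t' [adm' ->]]].
apply/derivation_iso_diamond/eqP => [[s [<- <-]] | /(congr1 val)].
  apply: val_inj; rewrite /= !class_index_der card_imset; last exact: perm_inj.
  by case: t adm.
rewrite /= !class_index_der.
have leS (U : {set 'I_(n - 2)}) : #|U| <= n - 2.
  by rewrite -[leqRHS]card_ord max_card.
have ltS (U : {set 'I_(n - 2)}) i : i \in U -> 0 < #|U|.
  by move=> Ui; apply/card_gt0P; exists i.
move: (leS S) (leS S') => /= leSS leSS'.
case: t t' adm adm' => [|i|] [|i'|] /= adm adm' eq_index.
- by have [s sS] := exists_perm_imset _ _ _ eq_index; exists s.
- by have /= := ltS _ _ adm'; lia.
- by lia.
- by have /= := ltS _ _ adm; lia.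
- have [s sS si] := exists_perm_imset_point _ _ _ _ _ (addnI eq_index) adm adm'.
  by exists s; rewrite /= si.
- by lia.
- by lia.
- by lia.
- exists 1%g; split=> //; rewrite (eqP adm) (eqP adm').
  by rewrite (eq_imset _ (perm1 (T := _))) imset_id.
Qed.

Lemma class_index_onto :
  class_index @: derivations (diamond n) = setT.
Proof.
apply/setP=> k; rewrite inE.
suff [S [t [adm eqk]]] : exists S t, admissible S t /\
    class_index (diamond_der S t) = k.
  by rewrite -eqk; apply/imset_f/derivations_diamond; exists S, t.
have [le_km | lt_mk] := leqP k (n - 2).
  have [S cardS] := exists_card_set _ _ le_km; exists S, DBot; split=> //.
  by apply: val_inj; rewrite /= class_index_der.
have [le_k | lt_k] := leqP k (2 * (n - 2)).
  have /exists_card_set[S cardS] : k - (n - 2) <= n - 2.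
    by rewrite leq_subLR addnn -mul2n.
  have /card_gt0P[i Si] : 0 < #|S| by rewrite cardS subn_gt0.
  exists S, (DAtom i); split=> //.
  by apply: val_inj; rewrite /= class_index_der cardS subnKC // ltnW.
exists setT, DTop; split; first exact: eqxx.
apply: val_inj; rewrite /= class_index_der; apply/eqP.
by rewrite eqn_leq lt_k -ltnS ltn_ord.
Qed.

Lemma card_derivation_classes_diamond :
  #|derivation_classes (diamond n)| = (2 * (n - 2)).+2.
Proof.
rewrite /derivation_classes.
rewrite (card_equivalence_partition_kernel _ _ _ _ _ derivation_iso_class_index).
by rewrite class_index_onto cardsT card_ord.
Qed.

End Diamond.

Lemma sum_cardS (m : nat) :
  \sum_(S : {set 'I_m}) (#|S| + 1) = \sum_(k < m.+1) (k + 1) * 'C(m, k).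
Proof.
have cardS_lt (S : {set 'I_m}) : #|S| < m.+1.
  by rewrite ltnS -[leqRHS]card_ord max_card.
rewrite (partition_big (fun S => Ordinal (cardS_lt S)) xpredT) //=.
apply: eq_bigr => k _.
rewrite (eq_bigr (fun=> k + 1)) => [|S /eqP<- //].
rewrite sum_nat_const mulnC -[m in 'C(m, _)]card_ord -card_draws cardsE.
by congr (_ * _).
Qed.

Theorem theorem3p21 (n : nat) (hn : 3 <= n) :
  #|derivations (diamond n)| = 2 + \sum_(1 <= k < (n - 2).+1) (k + 1) * 'C(n - 2, k) /\
  #|derivation_classes (diamond n)| = 2 * (n - 1).
Proof.
split; last first.
  by rewrite card_derivation_classes_diamond; lia.
rewrite card_derivations_diamond sum_cardS.
(* The empty set of fixed atoms contributes 1, and the identity another 1. *)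
by rewrite -(big_mkord xpredT (fun k => (k + 1) * 'C(n - 2, k))) big_ltn //
           bin0 addnC addnA.
Qed.
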